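(* $(\mathcal{M},d_{\mathcal{M}})$ is a metric space.
   Context: $(X,d_X,\mu)$ is a metric measure space: $(X,d_X)$ is a locally compact separable metric space and $\mu$ is a Borel regular measure with $0<\mu(B(x,r))<\infty$ for every ball. $\mathcal{M}$ is the set of all non-negative finite Borel measures $\nu$ on $X$ with compact support and $\nu\le\mu$; $\|\nu\|=\nu(X)$. Fix a strictly increasing continuous function $h:[0,\infty)\to[0,\infty)$ with $h(0)=\lim_{\varepsilon\to0^+}h(\varepsilon)/\varepsilon=0$, $h(\varepsilon_1)+h(\varepsilon_2)\le h(\varepsilon_1+\varepsilon_2)$ for all $\varepsilon_1,\varepsilon_2\ge0$, and $\lim_{\varepsilon\to\infty}h(\varepsilon)=\infty$. For $\nu,\eta\in\mathcal{M}$ and $\varepsilon,\delta>0$, $\Gamma_{\varepsilon,\delta}(\nu,\eta)$ is the set of families $(\nu_i,\eta_i)_{i\in\mathbb{M}}$ with $\mathbb{M}$ at most countable, $\nu_i,\eta_i\in\mathcal{M}$ for each $i$, $\nu=\sum_i\nu_i$, $\eta=\sum_i\eta_i$, $\sum_i\bigl|\|\nu_i\|-\|\eta_i\|\bigr|\le\delta$ and $\mathrm{diam}(\mathrm{supp}(\nu_i)\cup\mathrm{supp}(\eta_i))\le\varepsilon$ for each $i$ (the support of the zero measure is empty and $\mathrm{diam}(\emptyset)=0$). Put $\Gamma_\varepsilon(\nu,\eta)=\Gamma_{\varepsilon,h(\varepsilon)}(\nu,\eta)$ and $$d_{\mathcal{M}}(\nu,\eta)=\inf\{\varepsilon>0:\Gamma_\varepsilon(\nu,\eta)\ne\emptyset\}.$$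 *)

(* Defs.v *)
From HB Require Import structures.
From mathcomp Require Import all_boot all_order all_algebra.
From mathcomp Require Import all_classical all_reals all_analysis.

Set Implicit Arguments.
Unset Strict Implicit.
Unset Printing Implicit Defensive.

Import Order.TTheory GRing.Theory Num.Theory.
Import numFieldNormedType.Exports.

Local Open Scope classical_set_scope.
Local Open Scope ring_scope.

(* A measurableType is pointed, so Borel sets are considered on nonempty
   metric spaces. *)
#[short(type="pointedMetricType")]
HB.structure Definition PointedMetric (R : numDomainType) :=
  {T of Pointed T & Metric R T}.

Definition separable_space (T : topologicalType) : Prop :=
  exists2 D : set T, countable D & dense D.

Notation borel T := (g_sigma_algebraType (@open T)).

(* As usual in geometric measure theory, a Borel regular measure is an outer
   measure on all subsets. *)
Definition borel_regular (R : realType) (T : ptopologicalType)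
    (mu : {outer_measure set T -> \bar R}) : Prop :=
  (forall B : set (borel T), measurable B -> mu.-caratheodory B) /\
  (forall A : set T, exists B : set (borel T),
    [/\ measurable B, A `<=` B & mu B = mu A]).

Record metric_measure_space (R : realType) (X : pointedMetricType R)
    (mu : {outer_measure set X -> \bar R}) : Prop := {
  mms_locally_compact : locally_compact [set: X] ;
  mms_separable : separable_space X ;
  mms_borel_regular : borel_regular mu ;
  mms_ball : forall (x : X) (r : R), 0 < r -> (0 < mu (ball x r) < +oo)%E
}.

Record gauge_function (R : realType) (h : R -> R) : Prop := {
  gauge_ge0 : forall e, 0 <= e -> 0 <= h e ;
  gauge_increasing : forall e1 e2, 0 <= e1 -> e1 < e2 -> h e1 < h e2 ;
  gauge_continuous : {within [set e : R | 0 <= e], continuous h} ;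
  gauge0 : h 0 = 0 ;
  gauge_little_o : h e / e @[e --> 0^'+] --> (0 : R) ;
  gauge_superadditive :
    forall e1 e2, 0 <= e1 -> 0 <= e2 -> h e1 + h e2 <= h (e1 + e2) ;
  gauge_cvgy : h e @[e --> +oo] --> +oo
}.

Section space_of_measures.
Context (R : realType) (X : pointedMetricType R).

Definition measure_support (nu : set X -> \bar R) : set X :=
  [set x | forall U : set X, open_nbhs x U -> (0 < nu U)%E].

(* The maximum with 0 only matters for the empty set, where ereal_sup is
   -oo. *)
Definition diam (A : set X) : \bar R :=
  maxe 0%E (ereal_sup [set (mdist p.1 p.2)%:E | p in A `*` A]).

Variable mu : {outer_measure set X -> \bar R}.

(* A {measure set T -> \bar R} is a function on all subsets of T, constrained
   on measurable sets only. The last field fixes its irrelevant values, so that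
   Leibniz equality of elements of calM is equality on Borel sets. *)
Record calM := CalM {
  calM_measure :> {finite_measure set (borel X) -> \bar R} ;
  calM_compact : compact (measure_support calM_measure) ;
  calM_le : forall B : set (borel X), measurable B ->
    (calM_measure B <= mu B)%E ;
  calM_junk : forall B : set (borel X), ~ measurable B ->
    calM_measure B = 0%E
}.

Definition mass (nu : calM) : R := fine (nu [set: borel X]).

Record calM_family := CalMFamily {
  family_index : countType ;
  family_fst : family_index -> calM ;
  family_snd : family_index -> calM
}.

Definition measure_sum (I : countType) (nu_ : I -> calM) (nu : calM) : Prop :=
  forall B : set (borel X), measurable B ->
    nu B = (\esum_(i in [set: I]) nu_ i B)%E.

Definition Gamma2 (e d : R) (nu eta : calM) (F : calM_family) : Prop :=
  [/\
    measure_sum (@family_fst F) nu,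
    measure_sum (@family_snd F) eta,
    (\esum_(i in [set: family_index F])
       (`|mass (family_fst i) - mass (family_snd i)|)%:E <= d%:E)%E &
    forall i : family_index F,
      (diam (measure_support (family_fst i) `|`
             measure_support (family_snd i)) <= e%:E)%E].

Variable h : R -> R.

Definition Gamma (e : R) (nu eta : calM) : calM_family -> Prop :=
  Gamma2 e (h e) nu eta.

(* Extended-real-valued, so that finiteness is part of being a metric. *)
Definition dist_calM (nu eta : calM) : \bar R :=
  ereal_inf [set e%:E | e in [set e : R | 0 < e /\ exists F, Gamma e nu eta F]].

End space_of_measures.

(* T carries a metricType structure whose distance is d. *)
Definition is_metric_space (R : realType) (T : Type) (d : T -> T -> \bar R) :
    Prop :=
  exists c : Metric.axioms_ R T,
    forall x y : T, d x y = (@mdist R (Metric.Pack c) x y)%:E.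

(* Main.v *)
Require Import Defs.
From HB Require Import structures.
From mathcomp Require Import all_boot all_order all_algebra.
From mathcomp Require Import all_classical all_reals all_analysis.
From mathcomp Require Import ring lra.

Set Implicit Arguments.
Unset Strict Implicit.
Unset Printing Implicit Defensive.

Import Order.TTheory GRing.Theory Num.Theory.

Local Open Scope classical_set_scope.
Local Open Scope ring_scope.

(** Finiteness of the distance holds because two compact supports lie in a
    bounded set: the one-pair family is admissible as soon as [e] exceeds the
    diameter of that set and [h e] exceeds the difference of the masses.
    The distance from [nu] to itself vanishes because [nu] is the sum of its
    restrictions to the cells of a countable Borel partition of [X] into small
    cells, which separability provides. Symmetry is clear.

    Triangle inequality ([Gamma_triangle]). Let [(nu_i, eta_i)] and
    [(eta'_j, zeta_j)] be admissible for [e1] and [e2], with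
    [eta = sum eta_i = sum eta'_j]. Only the numbers saying how much mass the
    middle pieces [eta_i] and [eta'_j] share are needed, not a common
    refinement of measures. With a partition of [X] into Borel cells [B_k] of
    diameter at most [delta], put
      [m i j k = eta_i(B_k) * eta'_j(B_k) / eta(B_k)].
    Then [sum_jk m i j k = |eta_i|], [sum_ik m i j k = |eta'_j|], and
    [m i j k <> 0] forces the supports of [eta_i] and [eta'_j] to both meet
    [B_k]. Pair [(m i j k / |eta_i|) nu_i] with [(m i j k / |eta'_j|) zeta_j];
    the [nu_i] with [|eta_i| = 0] and the [zeta_j] with [|eta'_j| = 0] are
    paired with the zero measure. The diameters are at most
    [e1 + e2 + delta]. The masses differ in total by at most the sum of the
    two original costs, hence by at most
    [h e1 + h e2 <= h (e1 + e2) <= h (e1 + e2 + delta)]; [delta] is arbitrary.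

    Separation ([dist_calM_eq0]). If [(nu_i, eta_i)] is admissible for
    [e < e'] and [C] is closed, each [nu_i] that charges [C] has its partner
    [eta_i] supported in the [e']-neighborhood of [C], so that
    [nu(C) <= eta(C^e') + h e]. At distance [0] one may let [e'] and [e] tend
    to [0], which gives [nu(C) <= eta(C)], and equality by symmetry; closed
    sets determine a finite Borel measure. *)

(** * Sums of nonnegative families *)

Section esum_extra.
Context (R : realType).
Local Open Scope ereal_scope.

Lemma esumZl (I : choiceType) (c : R) (a : I -> \bar R) : (0 <= c)%R ->
  (forall i, 0 <= a i) ->
  \esum_(i in [set: I]) (c%:E * a i) = c%:E * \esum_(i in [set: I]) a i.
Proof.
move=> c0 a0; rewrite /esum -ereal_supZl//; last first.
  by apply/set0P; exists 0, set0; [exact: fsets_set0|rewrite fsbig_set0].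
congr ereal_sup.
apply/seteqP; split => [_ [A fA <-]|_ [_ [A fA <-] <-]].
- exists (\sum_(i \in A) a i); first by exists A.
  by rewrite ge0_mule_fsumr.
- by exists A => //; rewrite ge0_mule_fsumr.
Qed.

Lemma esum_pair (I J : choiceType) (f : I * J -> \bar R) :
  (forall p, 0 <= f p) ->
  \esum_(p in [set: I * J]) f p =
  \esum_(i in [set: I]) \esum_(j in [set: J]) f (i, j).
Proof.
move=> f0; rewrite (esum_esum (J := fun=> setT))//.
rewrite (_ : _ `*`` _ = setT); first by apply: eq_esum => -[].
by apply/seteqP; split.
Qed.

Lemma esum_prod_swap (I J : choiceType) (f : I * J -> \bar R) :
  \esum_(p in [set: I * J]) f p = \esum_(p in [set: J * I]) f (p.2, p.1).
Proof.
apply: reindex_esum; split => //.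
- by move=> [? ?] [? ?] _ _ [-> ->].
- by move=> [i j] _; exists (j, i).
Qed.

Lemma esum_sum_type (I J : choiceType) (f : I + J -> \bar R) :
  (forall p, 0 <= f p) ->
  \esum_(p in [set: I + J]) f p =
  \esum_(i in [set: I]) f (inl i) + \esum_(j in [set: J]) f (inr j).
Proof.
move=> f0; rewrite (esumID (range inl))// !setTI.
congr (_ + _); first by rewrite esum_image// => ? ? _ _ [].
rewrite (_ : ~` _ = range inr) ?esum_image//; first by move=> ? ? _ _ [].
apply/seteqP; split => [[i|j] h|_ [j _ <-] []//].
- by exfalso; apply: h; exists i.
- by exists j.
Qed.

Lemma le_esum_term (I : choiceType) (i : I) (a : I -> \bar R) :
  (forall i, 0 <= a i) -> a i <= \esum_(i in [set: I]) a i.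
Proof.
move=> a0; rewrite (esumID [set i])// setTI esum_set1//.
by rewrite leeDl// esum_ge0.
Qed.

End esum_extra.

(** * Splitting families along a coupling *)

Section spread.
Context (R : realType) (I J K : countType).

(** [m i j k / s i] is the share of the [i]-th piece that goes to the pair
    [(i, (j, k))]. The indices [inr (inl i)] collect the pieces with [s i = 0],
    which have no share to give (division by [0] yields [0]); the indices
    [inr (inr j)] are the partners of the leftovers of the other side. *)
Definition lspread (m : I -> J -> K -> R) (s x : I -> R)
    (t : I * (J * K) + (I + J)) : R :=
  match t with
  | inl (i, (j, k)) => m i j k / s i * x i
  | inr (inl i) => (s i == 0)%:R * x i
  | inr (inr _) => 0
  end.

Variables (m : I -> J -> K -> R) (s : I -> R).
Hypothesis m0 : forall i j k, 0 <= m i j k.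
Hypothesis ms :
  forall i, (\esum_(p in [set: J * K]) (m i p.1 p.2)%:E = (s i)%:E)%E.

Lemma le_marginal i j k : m i j k <= s i.
Proof.
rewrite -lee_fin -ms.
apply: (le_esum_term (j, k) (a := fun p => (m i p.1 p.2)%:E)) => p.
by rewrite lee_fin.
Qed.

Lemma marginal_ge0 i : 0 <= s i.
Proof. by rewrite -lee_fin -ms esum_ge0// => p _; rewrite lee_fin. Qed.

Lemma lspread_ge0 x t : (forall i, 0 <= x i) -> 0 <= lspread m s x t.
Proof.
move=> x0; case: t => [[i [j k]]|[i|j]] //=; rewrite mulr_ge0//.
by rewrite divr_ge0// marginal_ge0.
Qed.

(** The shares of each [i], leftover included, add up to [1]: either
    [s i <> 0] and they are [(sum_jk m i j k) / s i + 0], or [s i = 0] and they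
    are [0 + 1]. *)
Lemma esum_lspread x : (forall i, 0 <= x i) ->
  (\esum_(t in setT) (lspread m s x t)%:E = \esum_(i in setT) (x i)%:E)%E.
Proof.
move=> x0; have l0 t := lspread_ge0 t x0.
rewrite esum_sum_type; last by move=> t; rewrite lee_fin.
rewrite esum_sum_type; last by move=> t; rewrite lee_fin.
rewrite [X in (_ + (_ + X))%E]esum1 ?adde0//.
rewrite esum_pair; last by move=> t; rewrite lee_fin.
rewrite -esumD.
- apply: eq_esum => i _.
  rewrite (eq_esum
    (b := fun p => ((x i / s i)%:E * (m i p.1 p.2)%:E)%E)); last first.
    by move=> [j k] _ /=; rewrite -EFinM; congr EFin; ring.
  rewrite esumZl ?divr_ge0 ?marginal_ge0//; last by move=> p; rewrite lee_fin.
  rewrite ms -EFinM -EFinD /=; congr EFin.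
  by have [->|s0] := eqVneq (s i) 0; [rewrite mulr0 mul1r add0r|
    rewrite divfK// mul0r addr0].
- by move=> i _; apply: esum_ge0 => p _; rewrite lee_fin l0.
- by move=> i _; rewrite lee_fin (l0 (inr (inl i))).
Qed.

End spread.

Section coupling.
Context (R : realType) (I J : countType).
(** In the application [a i k], [b j k] and [c k] are the masses that
    [eta_ i], [eta'_ j] and their common sum [eta] give to the cell [k]; inside
    each cell the coupling is the independent one. *)
Variables (a : I -> nat -> R) (b : J -> nat -> R) (c : nat -> R).
Hypothesis a0 : forall i k, 0 <= a i k.
Hypothesis b0 : forall j k, 0 <= b j k.
Hypothesis ac : forall k, (\esum_(i in setT) (a i k)%:E = (c k)%:E)%E.
Hypothesis bc : forall k, (\esum_(j in setT) (b j k)%:E = (c k)%:E)%E.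

Lemma coupling_ge0 i j k : 0 <= a i k * b j k / c k.
Proof.
rewrite divr_ge0 ?mulr_ge0// -lee_fin -ac esum_ge0// => p _; exact: a0.
Qed.

Lemma coupling_marginal i :
  (\esum_(p in [set: J * nat]) (a i p.2 * b p.1 p.2 / c p.2)%:E =
   \esum_(k in setT) (a i k)%:E)%E.
Proof.
rewrite esum_prod_swap esum_pair; last first.
  by move=> p; rewrite lee_fin coupling_ge0.
apply: eq_esum => k _ /=.
have c0 : 0 <= c k by rewrite -lee_fin -ac esum_ge0// => p _; exact: a0.
rewrite (eq_esum (b := fun j => ((a i k / c k)%:E * (b j k)%:E)%E)); last first.
  by move=> j _; rewrite -EFinM; congr EFin; ring.
rewrite esumZl ?divr_ge0//; last by move=> p; rewrite lee_fin.
rewrite bc -EFinM; congr EFin.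
have [ck|ck] := eqVneq (c k) 0; last by rewrite divfK.
(* if [c k = 0] the quotient is [0], but so is [a i k <= c k] *)
rewrite ck mulr0; apply/esym/eqP; rewrite eq_le a0 andbT.
rewrite -lee_fin -[X in (_ <= X%:E)%E]ck -ac.
by apply: (le_esum_term i (a := fun i => (a i k)%:E)) => p; rewrite lee_fin.
Qed.

End coupling.

Section double_spread.
Context (R : realType) (I J K : countType).

Definition swap_index (t : I * (J * K) + (I + J)) : J * (I * K) + (J + I) :=
  match t with
  | inl (i, (j, k)) => inl (j, (i, k))
  | inr (inl i) => inr (inr i)
  | inr (inr j) => inr (inl j)
  end.

Lemma swap_index_bij : set_bij setT setT swap_index.
Proof.
split => //.
- by move=> [[i [j k]]|[i|j]] [[i' [j' k']]|[i'|j']] _ _ //= [] *; subst.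
- move=> [[j [i k]]|[j|i]] _.
  + by exists (inl (i, (j, k))).
  + by exists (inr (inr j)).
  + by exists (inr (inl i)).
Qed.

Definition rspread (m : I -> J -> K -> R) (r y : J -> R)
    (t : I * (J * K) + (I + J)) : R :=
  lspread (fun j i k => m i j k) r y (swap_index t).

Variables (m : I -> J -> K -> R) (s : I -> R) (r : J -> R).
Hypothesis m0 : forall i j k, 0 <= m i j k.
Hypothesis ms :
  forall i, (\esum_(p in [set: J * K]) (m i p.1 p.2)%:E = (s i)%:E)%E.
Hypothesis mr :
  forall j, (\esum_(p in [set: I * K]) (m p.1 j p.2)%:E = (r j)%:E)%E.

Lemma rspread_ge0 y t : (forall j, 0 <= y j) -> 0 <= rspread m r y t.
Proof. by move=> y0; apply: lspread_ge0. Qed.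

Lemma esum_rspread y : (forall j, 0 <= y j) ->
  (\esum_(t in setT) (rspread m r y t)%:E = \esum_(j in setT) (y j)%:E)%E.
Proof.
move=> y0; rewrite -(esum_lspread (m := fun j i k => m i j k) _ mr y0)//.
by rewrite (reindex_esum _ _ _ _ swap_index_bij).
Qed.

(** On the pair [(i, (j, k))] the splittings of [s] and [r] both have the value
    [m i j k], and on leftovers both vanish. The difference therefore does not
    change when [x] and [y] are replaced by [x - s] and [y - r]. *)
Lemma dist_spread_le x y t :
  `|lspread m s x t - rspread m r y t| <=
  lspread m s (fun i => `|x i - s i|) t + rspread m r (fun j => `|y j - r j|) t.
Proof.
have s0 i := marginal_ge0 m0 ms i.
have m0' j i k := m0 i j k.
have r0 j := marginal_ge0 (m := fun j i k => m i j k) m0' mr j.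
have eq0 (u v : R) : 0 <= u -> u <= v -> u / v * v = u.
  move=> u0 uv; have [v0|v0] := eqVneq v 0; last by rewrite divfK.
  by rewrite v0 mulr0; apply/eqP; rewrite eq_le u0/= -v0.
rewrite /rspread; case: t => [[i [j k]]|[i|j]] /=.
- have mi := eq0 _ _ (m0 i j k) (le_marginal m0 ms i j k).
  have mj := eq0 _ _ (m0 i j k)
    (le_marginal (m := fun j i k => m i j k) m0' mr j i k).
  rewrite (_ : _ - _ =
    m i j k / s i * (x i - s i) - m i j k / r j * (y j - r j)); last first.
    by rewrite !mulrBr mi mj; ring.
  rewrite (le_trans (ler_normB _ _))// (normrM (m i j k / s i)).
  rewrite (normrM (m i j k / r j)) (ger0_norm (divr_ge0 (m0 i j k) (s0 i))).
  by rewrite (ger0_norm (divr_ge0 (m0 i j k) (r0 j))).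
- rewrite subr0 addr0 normrM ger0_norm//.
  by have [->|] := eqVneq (s i) 0; rewrite ?subr0// !mul0r.
- rewrite sub0r normrN add0r normrM ger0_norm//.
  by have [->|] := eqVneq (r j) 0; rewrite ?subr0// !mul0r.
Qed.

End double_spread.

(** * From a distance function to a metric space *)

Lemma is_metric_space_of_dist (R : realType) (T : Type) (d : T -> T -> \bar R) :
  (forall x y, 0 <= d x y < +oo)%E -> (forall x, d x x = 0%E) ->
  (forall x y, d x y = 0%E -> x = y) -> (forall x y, d x y = d y x) ->
  (forall y x z, d x z <= d x y + d y z)%E ->
  is_metric_space d.
Proof.
move=> dfin dxx d0 dsym dtri.
have fin x y : d x y \is a fin_num.
  by rewrite ge0_fin_numE; case/andP: (dfin x y).
pose C : choiceType := HB.pack T (gen_eqMixin T) (gen_choiceMixin T).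
pose f (x y : C) : R := fine (d x y).
have fxx x : f x x = 0 by rewrite /f dxx.
have f0 x y : f x y = 0 -> x = y.
  by move=> fxy; apply: d0; rewrite -[LHS]fineK// -[fine _]/(f x y) fxy.
have fsym x y : f x y = f y x by rewrite /f dsym.
have ftri y x z : f x z <= f x y + f y z.
  by rewrite /f -fineD// fine_le// fin_numD !fin.
pose M : metricType R := HB.pack C (isMetric.Build R C fxx f0 fsym ftri).
exists (Metric.class M) => x y.
by rewrite [X in _ = X%:E](_ : _ = f x y)// /f fineK.
Qed.

(** * The space of measures *)

Lemma finite_measure_ext d (T : measurableType d) (R : realType)
    (m1 m2 : {finite_measure set T -> \bar R}) :
  m1 = m2 :> (set T -> \bar R) -> m1 = m2.
Proof.
case: m1 => f1 [[a1 b1] [c1] [d1] [e1] [g1]].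
case: m2 => f2 [[a2 b2] [c2] [d2] [e2] [g2]] /= f12.
subst f2.
have a12 := Prop_irrelevance a1 a2; subst a2.
have b12 := Prop_irrelevance b1 b2; subst b2.
have c12 := Prop_irrelevance c1 c2; subst c2.
have d12 := Prop_irrelevance d1 d2; subst d2.
have e12 := Prop_irrelevance e1 e2; subst e2.
have g12 := Prop_irrelevance g1 g2; subst g2.
by [].
Qed.

Section calM_theory.
Context (R : realType) (X : pointedMetricType R).
Variable mu : {outer_measure set X -> \bar R}.
Local Notation calM := (calM mu).
Implicit Types (nu eta : calM) (A B : set (borel X)).

Lemma calM_ext nu eta :
  (forall B, measurable B -> nu B = eta B) -> nu = eta.
Proof.
move=> nueta.
have : nu = eta :> (set (borel X) -> \bar R).
  apply/funext => B; have [mB|nB] := pselect (measurable B); first exact: nueta.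
  by rewrite !calM_junk.
case: nu eta {nueta} => m1 c1 l1 j1 [m2 c2 l2 j2] /= /finite_measure_ext m12.
subst m2.
by rewrite (Prop_irrelevance c1 c2) (Prop_irrelevance l1 l2)
  (Prop_irrelevance j1 j2).
Qed.

Lemma open_borel (U : set X) : open U -> measurable (U : set (borel X)).
Proof. exact: sub_sigma_algebra. Qed.

Lemma closed_borel (C : set X) : closed C -> measurable (C : set (borel X)).
Proof.
move=> cC; rewrite -(setCK C); apply: measurableC.
by apply: open_borel; apply: closed_openC.
Qed.

Lemma calM_fin nu B : nu B \is a fin_num.
Proof.
have [mB|nB] := pselect (measurable B); first exact: fin_num_measure.
by rewrite calM_junk.
Qed.

Lemma massE nu : (mass nu)%:E = nu setT.
Proof. by rewrite /mass fineK// calM_fin. Qed.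

Lemma le_measure_support (m1 m2 : set X -> \bar R) :
  (forall U, open U -> m1 U <= m2 U)%E ->
  measure_support m1 `<=` measure_support m2.
Proof.
by move=> m12 x + U oU => /(_ U oU)/lt_le_trans; apply; apply/m12/oU.1.
Qed.

Lemma closed_measure_support (m : set X -> \bar R) : closed (measure_support m).
Proof.
move=> x clx U [oU Ux].
have [y [+ Uy]] := clx U (open_nbhs_nbhs (conj oU Ux)).
by apply.
Qed.

(** [m] need not vanish on nonmeasurable sets: it has to be reset there before
    it becomes an element of [calM]. *)
Lemma calM_of_le nu (m : {measure set (borel X) -> \bar R}) :
  (forall B, measurable B -> m B <= nu B)%E ->
  exists eta, forall B, measurable B -> eta B = m B.
Proof.
move=> mnu.
pose f (B : set (borel X)) : \bar R := if B \in measurable then m B else 0%E.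
have fE B : measurable B -> f B = m B by move=> mB; rewrite /f mem_set.
have f_set0 : f set0 = 0%E by rewrite fE// measure0.
have f_ge0 B : (0 <= f B)%E by rewrite /f; case: ifP.
have f_sigma : semi_sigma_additive f.
  move=> F mF tF mUF; rewrite fE//.
  under eq_fun do under eq_bigr do rewrite fE//.
  exact: measure_semi_sigma_additive.
have f_fin : fin_num_fun f.
  move=> B mB; rewrite fE// ge0_fin_numE//.
  by rewrite (le_lt_trans (mnu _ mB))// -ge0_fin_numE// calM_fin.
pose fm : {measure set (borel X) -> \bar R} :=
  HB.pack f (isMeasure.Build _ _ _ f f_set0 f_ge0 f_sigma).
pose ff : {finite_measure set (borel X) -> \bar R} :=
  HB.pack (Measure.sort fm) (Measure_isFinite.Build _ _ _ fm f_fin).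
have ffE B : measurable B -> ff B = m B := fE B.
have fnu : measure_support ff `<=` measure_support nu.
  by apply: le_measure_support => U /open_borel mU; rewrite ffE// mnu.
have fcomp : compact (measure_support ff).
  by apply: subclosed_compact fnu; [exact: closed_measure_support|
    exact: calM_compact].
have fle B : measurable B -> (ff B <= mu B)%E.
  by move=> mB; rewrite ffE// (le_trans (mnu _ mB))// calM_le.
have fjunk B : ~ measurable B -> ff B = 0%E.
  by move=> nB; rewrite /= /f memNset.
by exists (CalM fcomp fle fjunk) => B mB; exact: ffE.
Qed.

Lemma calM_scale_restr nu (c : R) (A : set (borel X)) :
  0 <= c <= 1 -> measurable A ->
  exists eta, forall B, measurable B -> eta B = (c%:E * nu (B `&` A))%E.
Proof.
move=> /andP[c0 c1] mA.
have [|eta etaE] := @calM_of_le nu (mscale (NngNum c0) (mrestr nu mA)).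
  move=> B mB; rewrite /mscale/= /mrestr.
  apply: (@le_trans _ _ (nu (B `&` A))).
    by rewrite -[leRHS]mul1e lee_wpmul2r// lee_fin.
  by apply: le_measure; rewrite ?inE//; exact: measurableI.
by exists eta => B mB; rewrite etaE.
Qed.

(** * Consequences of separability *)

Definition dense_sequence (d : nat -> X) : Prop :=
  forall x r, 0 < r -> exists n, ball (d n) r x.

Lemma dense_sequence_exists : separable_space X -> exists d, dense_sequence d.
Proof.
move=> [D cD dD].
have /pcard_surjP[d dD'] := cD.
exists d => x r r0.
have [y [xy Dy]] : (ball x r)^° `&` D !=set0.
  apply: dD; last exact: open_interior.
  by exists x; apply: nbhsx_ballx.
have [n _ dny] := dD' _ Dy; exists n.
by apply: ball_sym; rewrite dny; exact: interior_subset.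
Qed.

Lemma open_mball (x : X) (r : R) : open (ball x r).
Proof.
rewrite openE => y; rewrite ballEmdist /= => xy.
rewrite /interior -filter_from_ballE; exists (r - mdist x y).
  by rewrite /= subr_gt0.
move=> z; rewrite !ballEmdist/= => yz.
by rewrite (le_lt_trans (metric_triangle _ y _))// -ltrBrDl.
Qed.

Lemma ball_borel (x : X) (r : R) : measurable (ball x r : set (borel X)).
Proof. by apply: open_borel; exact: open_mball. Qed.

Lemma support_borel nu : measurable (measure_support nu : set (borel X)).
Proof. by apply: closed_borel; exact: closed_measure_support. Qed.

(** The complement of the support is covered by the null balls of radius
    [1 / p.+1] centered on the dense sequence, and there are countably many
    of them. *)
Lemma null_setC_support (d : nat -> X) nu : dense_sequence d ->
  nu (~` measure_support nu) = 0%E.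
Proof.
move=> dd.
pose B (p n : nat) : set (borel X) :=
  if nu (ball (d n) p.+1%:R^-1) == 0%E then ball (d n) p.+1%:R^-1 else set0.
have mB p n : measurable (B p n).
  by rewrite /B; case: ifP => _ //; exact: ball_borel.
have null : (nu : {measure set _ -> \bar R}).-negligible
    (\bigcup_p \bigcup_n B p n).
  apply: negligible_bigcup => p; apply: negligible_bigcup => n.
  apply/negligibleP => //; rewrite /B; case: ifPn => [/eqP //|_].
  exact: measure0.
apply/negligibleP; first by apply: measurableC; exact: support_borel.
apply: negligibleS null => x /existsNP[U /not_implyP[[oU Ux] /negP]].
rewrite -leNgt => U0; have := oU; rewrite openE => /(_ _ Ux).
rewrite /interior -filter_from_ballE => -[r /= r0 rU].
have [p pr] : exists p : nat, p.+1%:R^-1 < r / 2.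
  exists (Num.truncn (r / 2)^-1).
  by rewrite invf_plt ?posrE ?divr_gt0// truncnS_gt.
have [n xn] := dd x p.+1%:R^-1 ltac:(by rewrite invr_gt0).
exists p => //; exists n => //; rewrite /B ifT// -measure_le0.
apply: le_trans U0; apply: le_measure; rewrite ?inE.
- exact: ball_borel.
- exact: open_borel.
apply: subset_trans rU => y yn.
apply: (@le_ball _ _ _ (p.+1%:R^-1 + p.+1%:R^-1)).
  by rewrite [leRHS]splitr lerD// ltW.
by apply: ball_triangle yn; exact: ball_sym.
Qed.

Lemma support_meets (d : nat -> X) nu B : dense_sequence d -> measurable B ->
  nu B != 0%E -> exists2 x, B x & measure_support nu x.
Proof.
move=> dd mB; apply: contra_neqP => /forall2NP NB.
apply/eqP; rewrite -measure_le0 -(null_setC_support nu dd).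
apply: le_measure; rewrite ?inE//.
  by apply: measurableC; exact: support_borel.
by move=> x Bx; have [] := NB x.
Qed.

(** The diameter bound is on the closures of the cells because the support of
    a restriction to a cell is only contained in the closure. *)
Lemma borel_partition (d : nat -> X) (r : R) : dense_sequence d -> 0 < r ->
  exists B : nat -> set (borel X), [/\ forall k, measurable (B k),
    forall k x y, closure (B k : set X) x -> closure (B k : set X) y ->
      mdist x y <= r &
    forall nu A, measurable A -> nu A = (\esum_(k in setT) nu (A `&` B k))%E].
Proof.
move=> dd r0; pose F k : set (borel X) := ball (d k) (r / 2).
have mF k : measurable (F k) by exact: ball_borel.
have mS k : measurable (seqDU F k).
  by apply: seqDU_measurable.
exists (seqDU F); split => //.
- have near_center k x :
      closure (seqDU F k : set X) x -> mdist (d k) x <= r / 2.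
    move=> clx; apply/ler_addgt0Pr => e e0.
    have [z [Bz xz]] := clx _ (nbhsx_ballx x e e0).
    have := subset_seqDU Bz; rewrite /F; move: xz.
    rewrite !ballEmdist/= => xz dz.
    have := metric_triangle (d k) z x; rewrite (metric_sym z x); lra.
  move=> k x y /near_center dx /near_center dy.
  have := metric_triangle x (d k) y; rewrite (metric_sym x (d k)); lra.
- move=> nu A mA; rewrite -nneseries_esumT//.
  rewrite -measure_semi_bigcup.
  + rewrite -setI_bigcupr -seqDU_bigcup_eq (_ : \bigcup_k F k = setT) ?setIT//.
    apply/seteqP; split => // x _; have [n xn] := dd x (r / 2) ltac:(lra).
    by exists n.
  + by move=> k; exact: measurableI.
  + by apply: trivIset_setIl; exact: trivIset_seqDU.
  + by apply: bigcup_measurable => k _; exact: measurableI.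
Qed.

(** * Triangle inequality *)

Lemma le_diam (A : set X) (e : R) : 0 <= e ->
  (diam A <= e%:E)%E <-> forall x y, A x -> A y -> mdist x y <= e.
Proof.
move=> e0; rewrite /diam ge_max lee_fin e0/=; split.
  move=> Ae x y Ax Ay; rewrite -lee_fin; apply: le_trans Ae.
  by apply: ereal_sup_ubound; exists (x, y).
move=> Ae; apply: ge_ereal_sup => _ [[x y] [/= Ax Ay] <-].
by rewrite lee_fin Ae.
Qed.

Lemma measure_sum_fine (I : countType) (nu_ : I -> calM) nu B :
  measure_sum nu_ nu -> measurable B ->
  (\esum_(i in setT) (fine (nu_ i B))%:E = (fine (nu B))%:E)%E.
Proof.
move=> nuE mB; rewrite fineK ?calM_fin// nuE//.
by apply: eq_esum => i _; rewrite fineK// calM_fin.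
Qed.

Lemma calM_scale nu (c : R) : 0 <= c <= 1 -> exists eta,
  [/\ forall B, measurable B -> eta B = (c%:E * nu B)%E,
      measure_support eta `<=` measure_support nu &
      c = 0 -> measure_support eta = set0].
Proof.
move=> c01; have [eta etaE] := calM_scale_restr nu c01 measurableT.
have {}etaE B : measurable B -> eta B = (c%:E * nu B)%E.
  by move=> mB; rewrite etaE// setIT.
case/andP: c01 => c0 c1; exists eta; split => //.
- apply: le_measure_support => U /open_borel mU.
  by rewrite etaE// -[leRHS]mul1e lee_wpmul2r// lee_fin.
- move=> c_eq0; apply/seteqP; split => // x xs.
  have := xs setT (conj openT I).
  by rewrite etaE// c_eq0 mul0e ltxx.
Qed.

Definition spread_support (I J K : Type) (m : I -> J -> K -> R)
    (S : I -> set X) (t : I * (J * K) + (I + J)) : set X :=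
  match t with
  | inl (i, (j, k)) => [set x | m i j k != 0 /\ S i x]
  | inr (inl i) => S i
  | inr (inr j) => set0
  end.

(** [nu0] is only there to be multiplied by [0] at the indices
    [inr (inr j)]: when [I] is empty the family [nu_] provides no element of
    [calM]. *)
Lemma spread_family (I J K : countType) (m : I -> J -> K -> R) (s : I -> R)
    (nu0 : calM) (nu_ : I -> calM) :
  (forall i j k, 0 <= m i j k) ->
  (forall i, (\esum_(p in [set: J * K]) (m i p.1 p.2)%:E = (s i)%:E)%E) ->
  exists nuT : I * (J * K) + (I + J) -> calM, forall t,
    (forall A, measurable A ->
       nuT t A = (lspread m s (fun i => fine (nu_ i A)) t)%:E) /\
    measure_support (nuT t) `<=`
      spread_support m (fun i => measure_support (nu_ i)) t.
Proof.
move=> m0 ms.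
have frac i j k : 0 <= m i j k / s i <= 1.
  have mi := le_marginal m0 ms i j k; have s0 := marginal_ge0 m0 ms i.
  rewrite divr_ge0//=; have [->|si] := eqVneq (s i) 0.
    by rewrite invr0 mulr0.
  by rewrite ler_pdivrMr ?mul1r// lt_neqAle eq_sym si.
have bool01 (P : bool) : 0 <= (P%:R : R) <= 1.
  by case: P; rewrite /= ?lexx ler01.
suff /choice [nuT nuTP] : forall t : I * (J * K) + (I + J), exists nut : calM,
    (forall A, measurable A ->
       nut A = (lspread m s (fun i => fine (nu_ i A)) t)%:E) /\
    measure_support nut `<=`
      spread_support m (fun i => measure_support (nu_ i)) t by exists nuT.
move=> [[i [j k]]|[i|j]] /=.
- have [nut [nutE sub empty]] := calM_scale (nu_ i) (frac i j k).
  exists nut; split.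
    by move=> A mA; rewrite nutE// [RHS]EFinM fineK// calM_fin.
  move=> x xs; split; last exact: sub.
  by apply/eqP => mijk; move: xs; rewrite empty// mijk mul0r.
- have [nut [nutE sub _]] := calM_scale (nu_ i) (bool01 (s i == 0)).
  exists nut; split => //.
  by move=> A mA; rewrite nutE// [RHS]EFinM fineK// calM_fin.
- have [nut [nutE _ /(_ erefl) supp0]] := calM_scale nu0 (bool01 false).
  by exists nut; split => [A mA|]; rewrite ?supp0// nutE// mul0e.
Qed.

Variable h : R -> R.

(** The extra [delta], the size of the cells in which the two decompositions of
    [eta] are compared, is harmless for the infimum defining the distance. *)
Lemma Gamma_triangle e1 e2 delta nu eta zeta F G :
  gauge_function h -> separable_space X -> 0 <= e1 -> 0 <= e2 -> 0 < delta ->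
  Gamma h e1 nu eta F -> Gamma h e2 eta zeta G ->
  exists H, Gamma h (e1 + e2 + delta) nu zeta H.
Proof.
move=> gh /dense_sequence_exists[d dd] e10 e20 delta0.
case: F => I nu_ eta_ [/= nuE etaE costF diamF].
case: G => J eta'_ zeta_ [/= eta'E zetaE costG diamG].
have [B [mB Bdiam BE]] := borel_partition dd delta0.
pose a i k := fine (eta_ i (B k)); pose b j k := fine (eta'_ j (B k)).
pose c k := fine (eta (B k)).
pose m i j k := a i k * b j k / c k.
pose s i := mass (eta_ i); pose r j := mass (eta'_ j).
have a0 i k : 0 <= a i k by rewrite fine_ge0.
have b0 j k : 0 <= b j k by rewrite fine_ge0.
have ac k : (\esum_(i in setT) (a i k)%:E = (c k)%:E)%E.
  exact: measure_sum_fine.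
have bc k : (\esum_(j in setT) (b j k)%:E = (c k)%:E)%E.
  exact: measure_sum_fine.
have m0 i j k : 0 <= m i j k by exact: coupling_ge0 a0 b0 ac i j k.
have BT (n : calM) : (\esum_(k in setT) (fine (n (B k)))%:E = (mass n)%:E)%E.
  rewrite massE (BE n setT)//; apply: eq_esum => k _.
  by rewrite setTI fineK// calM_fin.
have ms i : (\esum_(p in [set: J * nat]) (m i p.1 p.2)%:E = (s i)%:E)%E.
  by rewrite (coupling_marginal a0 b0 ac bc) BT.
have mr j : (\esum_(p in [set: I * nat]) (m p.1 j p.2)%:E = (r j)%:E)%E.
  rewrite -BT -(coupling_marginal b0 a0 bc ac).
  by apply: eq_esum => p _; rewrite /m (mulrC (a _ _)).
have [nuT nuTP] := spread_family nu nu_ m0 ms.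
have [zetaT' zetaTP] := @spread_family _ _ _ (fun j i k => m i j k) _ zeta
  zeta_ (fun j i k => m0 i j k) mr.
pose zetaT t := zetaT' (swap_index t).
exists (CalMFamily nuT zetaT); split => /=.
- move=> A mA; rewrite -[LHS]fineK ?calM_fin// -(measure_sum_fine nuE)//.
  rewrite -(esum_lspread m0 ms).
    by apply: eq_esum => t _; rewrite (nuTP t).1.
  by move=> i; rewrite fine_ge0.
- move=> A mA; rewrite -[LHS]fineK ?calM_fin// -(measure_sum_fine zetaE)//.
  rewrite -(esum_rspread m0 mr).
    by apply: eq_esum => t _; rewrite /zetaT (zetaTP _).1.
  by move=> i; rewrite fine_ge0.
- apply: (@le_trans _ _ (h e1 + h e2)%:E); last first.
    rewrite lee_fin (le_trans (gauge_superadditive gh e10 e20))//.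
    by apply/ltW/(gauge_increasing gh); [exact: addr_ge0|rewrite ltrDl].
  rewrite EFinD; apply: le_trans (leeD costF costG).
  rewrite -(esum_lspread m0 ms)// -(esum_rspread m0 mr)// -esumD.
  + apply: le_esum => t _; rewrite -EFinD lee_fin /mass (nuTP t).1//.
    rewrite (zetaTP _).1//=; apply: le_trans (dist_spread_le m0 ms mr _ _ _) _.
    rewrite lerD2l /r /rspread le_eqVlt; apply/orP; left; apply/eqP.
    by congr (lspread _ _ _ _); apply/funext => j; rewrite distrC.
  + by move=> t _; rewrite lee_fin lspread_ge0.
  + by move=> t _; rewrite lee_fin rspread_ge0.
- have meets (n : calM) k : fine (n (B k)) != 0 ->
      exists2 x, B k x & measure_support n x.
    by move=> nB; apply: (support_meets dd) => //; apply: contra_neq nB => ->.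
  have dF i := (le_diam _ e10).1 (diamF i).
  have dG j := (le_diam _ e20).1 (diamG j).
  move=> t; apply/le_diam; first by rewrite !addr_ge0// ltW.
  (* the path from [x] to [y] goes through the cell [B k], which meets the
     supports of [eta_ i] and [eta'_ j] *)
  have link i j k x y : m i j k != 0 -> measure_support (nu_ i) x ->
      measure_support (zeta_ j) y -> mdist x y <= e1 + e2 + delta.
    rewrite /m !mulf_eq0 !negb_or -andbA => /and3P[/meets[u Bu au] + _].
    move=> /meets[v Bv bv] nx zy.
    have := dF i x u (or_introl nx) (or_intror au).
    have := dG j v y (or_introl bv) (or_intror zy).
    have := Bdiam k u v (subset_closure Bu) (subset_closure Bv).
    have := metric_triangle x u y; have := metric_triangle u v y; lra.
  have := (zetaTP (swap_index t)).2; have := (nuTP t).2; rewrite -/(zetaT t).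
  case: t => [[i [j k]]|[i|j]] /= subN subZ x y.
  + move=> [/subN[mN xN]|/subZ[mN xZ]] [/subN[_ yN]|/subZ[_ yZ]].
    * by have := dF i x y (or_introl xN) (or_introl yN); lra.
    * exact: link mN xN yZ.
    * by rewrite metric_sym; exact: link mN yN xZ.
    * by have := dG j x y (or_intror xZ) (or_intror yZ); lra.
  + move=> [/subN xN|/subZ//] [/subN yN|/subZ//].
    by have := dF i x y (or_introl xN) (or_introl yN); lra.
  + move=> [/subN//|/subZ xZ] [/subN//|/subZ yZ].
    by have := dG j x y (or_intror xZ) (or_intror yZ); lra.
Qed.

(** * Small and finite distances *)

Lemma Gamma_refl e nu : gauge_function h -> separable_space X -> 0 < e ->
  exists F, Gamma h e nu nu F.
Proof.
move=> gh /dense_sequence_exists[d dd] e0.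
have [B [mB Bdiam BE]] := borel_partition dd e0.
have one01 : 0 <= (1 : R) <= 1 by rewrite lexx ler01.
have /choice[nu_ nu_E] : forall k, exists eta : calM,
    forall A, measurable A -> eta A = nu (A `&` B k).
  move=> k; have [eta etaE] := calM_scale_restr nu one01 (mB k).
  by exists eta => A mA; rewrite etaE// mul1e.
have nuE : measure_sum nu_ nu.
  by move=> A mA; rewrite (BE nu A mA); apply: eq_esum => k _; rewrite nu_E.
exists (CalMFamily nu_ nu_); split => //=.
- rewrite esum1 ?lee_fin ?(gauge_ge0 gh) ?ltW// => k _.
  by rewrite subrr normr0.
- move=> k; rewrite setUid; apply/le_diam; first exact: ltW.
  have sub : measure_support (nu_ k) `<=` closure (B k : set X).
    move=> x xs U; rewrite nbhsE => -[V oV VU].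
    have := xs V oV; rewrite nu_E; last exact: open_borel oV.1.
    have [->|/set0P[z [Vz Bz]] _] := eqVneq (V `&` B k) set0.
      by rewrite measure0 ltxx.
    by exists z; split => //; exact: VU.
  by move=> x y /sub xB /sub yB; exact: Bdiam xB yB.
Qed.

Lemma Gamma_sym e nu eta F : Gamma h e nu eta F -> exists G, Gamma h e eta nu G.
Proof.
move=> [nuE etaE cost dF].
exists (CalMFamily (@family_snd _ _ _ F) (@family_fst _ _ _ F)); split => //=.
- by apply: le_trans cost; apply: le_esum => i _; rewrite distrC.
- by move=> i; rewrite setUC.
Qed.

(** A compact set is covered by finitely many of the balls centered at [point]
    with natural radii. *)
Lemma compact_mdist_bounded (K : set X) : compact K ->
  exists M, forall x y, K x -> K y -> mdist x y <= M.
Proof.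
move=> /compact_near_coveringP cK.
have := cK nat \oo (fun n x => mdist point x < n%:R) _ _.
case=> [x _|N _ KN].
  exists (ball x 1, [set n | (Num.truncn (mdist point x + 1)).+1 <= n]%N).
    split; first exact: nbhsx_ballx.
    by exists (Num.truncn (mdist point x + 1)).+1.
  move=> [y n] [/= + xn]; rewrite ballEmdist/= => xy.
  apply: (@lt_le_trans _ _ (Num.truncn (mdist point x + 1)).+1%:R); last first.
    by rewrite ler_nat.
  apply: lt_trans (truncnS_gt _).
  by rewrite (le_lt_trans (metric_triangle _ x _))// ltrD2l.
exists (N%:R + N%:R) => x y /(KN N (leqnn N))/= xN /(KN N (leqnn N))/= yN.
have := metric_triangle x point y; rewrite (metric_sym x point); lra.
Qed.

Lemma Gamma_exists nu eta : gauge_function h ->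
  exists2 e, 0 < e & exists F, Gamma h e nu eta F.
Proof.
move=> gh.
have cnu := @calM_compact _ _ _ nu; have ceta := @calM_compact _ _ _ eta.
have [M bM] := compact_mdist_bounded (compactU cnu ceta).
near (pinfty_nbhs R) => e.
have e0 : 0 < e by near: e; apply: nbhs_pinfty_gt; exact: num_real.
have Me : M <= e by near: e; apply: nbhs_pinfty_ge; exact: num_real.
have he : `|mass nu - mass eta| <= h e.
  by near: e; have /cvgryPge := gauge_cvgy gh; exact.
have sum1 (n : calM) : measure_sum (fun _ : unit => n) n.
  move=> B mB; rewrite (_ : setT = [set tt]) ?esum_set1//.
  by apply/seteqP; split => // -[].
exists e => //; exists (CalMFamily (fun _ : unit => nu) (fun=> eta)).
split => //=.
- rewrite (_ : setT = [set tt]) ?esum_set1 ?lee_fin//.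
  by apply/seteqP; split => // -[].
- move=> _; apply/le_diam; first exact: ltW.
  by move=> x y Ax Ay; apply: le_trans Me; exact: bM.
Unshelve. all: by end_near. Qed.

(** * From admissible families to the distance *)

(** The inequality holds piece by piece: if [nu_i] charges [C], the bound on
    the diameter puts the support of [eta_i] inside [U], so that
    [nu_i C <= |nu_i|] and [eta_i U = |eta_i|]. *)
Lemma Gamma_closed_le e e' nu eta F (C : set X) : separable_space X ->
  closed C -> 0 <= e -> e < e' -> Gamma h e nu eta F ->
  (nu C <= eta (\bigcup_(y in C) ball y e') + (h e)%:E)%E.
Proof.
move=> /dense_sequence_exists[d dd] cC e0 ee' [nuE etaE cost dF].
set U : set (borel X) := \bigcup_(y in C) ball y e'.
have mC : measurable (C : set (borel X)) by exact: closed_borel.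
have mU : measurable U.
  by apply: open_borel; apply: bigcup_open => y _; exact: open_mball.
rewrite nuE// etaE//; apply: le_trans (leeD2l _ cost).
rewrite -esumD//; apply: le_esum => i _.
have [->|nuiC] := eqVneq (family_fst i C) 0%E.
  by rewrite adde_ge0// lee_fin.
have [x Cx xs] := support_meets dd mC nuiC.
have -> : family_snd i U = family_snd i setT.
  apply/eqP; rewrite eq_le le_measure ?inE//=.
  have mCU : measurable (~` U) by exact: measurableC.
  rewrite -(setUv U); apply: le_trans (measureU2 _ mU mCU) _.
  rewrite -[leRHS]adde0 leeD2l// -(null_setC_support (family_snd i) dd).
  apply: le_measure; rewrite ?inE.
  - exact: measurableC.
  - by apply: measurableC; exact: support_borel.
  apply: subsetC => y ys; exists x => //; rewrite ballEmdist/=.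
  apply: le_lt_trans ee'.
  by apply: (le_diam _ e0).1 (dF i) _ _ _ _; [left|right].
apply: (@le_trans _ _ (family_fst i setT)).
  by apply: le_measure; rewrite ?inE.
rewrite -!massE -EFinD lee_fin.
have := ler_norm (mass (family_fst i) - mass (family_snd i)); lra.
Qed.
Lemma gauge_small e : gauge_function h -> 0 < e ->
  exists2 r, 0 < r & forall t, 0 < t -> t < r -> h t <= e.
Proof.
move=> gh e0; have /cvgrPdist_lt/(_ 1 ltr01) := gauge_little_o gh.
move=> [r /= r0 rh]; exists (Num.min r e).
  by rewrite lt_min e0 andbT.
move=> t t0; rewrite lt_min => /andP[tr te].
have := rh t; rewrite /= sub0r normrN gtr0_norm// => /(_ tr t0).
rewrite sub0r normrN normrM normfV (gtr0_norm t0) ltr_pdivrMr// mul1r => ht.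
by rewrite (le_trans (ler_norm _))// ltW// (lt_trans ht).
Qed.

Lemma dist_calM_lt nu eta (e : R) : (dist_calM h nu eta < e%:E)%E ->
  exists e', [/\ 0 < e', e' < e & exists F, Gamma h e' nu eta F].
Proof.
by move=> /ereal_inf_lt[_ [e' [e'0 HF] <-]]; rewrite lte_fin => e'e; exists e'.
Qed.

Lemma dist_calM_le nu eta (e : R) : 0 < e -> (exists F, Gamma h e nu eta F) ->
  (dist_calM h nu eta <= e%:E)%E.
Proof. by move=> e0 HF; apply: ereal_inf_lbound; exists e. Qed.

Lemma dist_calM_ge0 nu eta : (0 <= dist_calM h nu eta)%E.
Proof. by apply: le_ereal_inf_tmp => _ [e [/ltW e0 _] <-]; rewrite lee_fin. Qed.

Lemma dist_calM_fin nu eta : gauge_function h ->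
  dist_calM h nu eta \is a fin_num.
Proof.
move=> gh; rewrite ge0_fin_numE ?dist_calM_ge0//.
have [e e0 HF] := Gamma_exists nu eta gh.
exact: le_lt_trans (dist_calM_le e0 HF) (ltry _).
Qed.

Lemma dist_calM_triangle nu eta zeta : gauge_function h -> separable_space X ->
  (dist_calM h nu zeta <= dist_calM h nu eta + dist_calM h eta zeta)%E.
Proof.
move=> gh sX; have f1 := dist_calM_fin nu eta gh.
have f2 := dist_calM_fin eta zeta gh.
apply/lee_addgt0Pr => e e0.
have e30 : 0 < e / 3 by rewrite divr_gt0.
have lt3 (x y : calM) : dist_calM h x y \is a fin_num ->
    (dist_calM h x y < (fine (dist_calM h x y) + e / 3)%:E)%E.
  by move=> fxy; rewrite -{1}(fineK fxy) lte_fin ltrDl.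
have [e1 [e10 e1lt [F GF]]] := dist_calM_lt (lt3 _ _ f1).
have [e2 [e20 e2lt [G GG]]] := dist_calM_lt (lt3 _ _ f2).
have HG := Gamma_triangle gh sX (ltW e10) (ltW e20) e30 GF GG.
apply: le_trans (dist_calM_le _ HG) _; first by rewrite !addr_gt0.
rewrite -(fineK f1) -(fineK f2) -!EFinD lee_fin; lra.
Qed.

(** [C] is the intersection of its open neighborhoods [U n] of radius
    [1 / n.+1], so that [eta (U n)] tends to [eta C]; admissible families exist
    at scales so small that their cost [h t] is negligible. *)
Lemma dist_calM_eq0_le nu eta (C : set X) : gauge_function h ->
  separable_space X -> closed C -> dist_calM h nu eta = 0%E ->
  (nu C <= eta C)%E.
Proof.
move=> gh sX cC nueta0.
pose U n : set (borel X) := \bigcup_(y in C) ball y n.+1%:R^-1.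
have mU n : measurable (U n).
  by apply: open_borel; apply: bigcup_open => y _; exact: open_mball.
have capU : \bigcap_n U n = C.
  apply/seteqP; split => [x Ux|x Cx n _]; last first.
    by exists x => //; apply: ballxx; rewrite invr_gt0.
  apply: cC => V; rewrite -filter_from_ballE => -[r /= r0 rV].
  have [n nr] : exists n : nat, n.+1%:R^-1 < r.
    exists (Num.truncn r^-1).
    by rewrite invf_plt ?posrE// truncnS_gt.
  have [y Cy yx] := Ux n I; exists y; split => //; apply: rV.
  by apply: (le_ball (ltW nr)); exact: ball_sym.
have Ucvg : eta (U n) @[n --> \oo] --> eta C.
  rewrite -capU; apply: nonincreasing_cvg_mu => //.
  - by rewrite ltey_eq calM_fin.
  - by rewrite capU; exact: closed_borel.
  - move=> n k nk; apply/subsetPset => x [y Cy yx]; exists y => //.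
    by apply: le_ball yx; rewrite lef_pV2 ?posrE// ler_nat ltnS.
have nuU n : (nu C <= eta (U n))%E.
  apply/lee_addgt0Pr => e e0.
  have [r r0 rh] := gauge_small gh e0.
  have [|t [t0 + [F GF]]] := @dist_calM_lt nu eta (Num.min r n.+1%:R^-1).
    by rewrite nueta0 lte_fin lt_min r0 invr_gt0 ltr0Sn.
  rewrite lt_min => /andP[tr tn].
  apply: le_trans (Gamma_closed_le sX cC (ltW t0) tn GF) _.
  by rewrite leeD2l// lee_fin rh.
apply: (cvge_ge _ Ucvg) => //.
by apply: nearW.
Qed.

Lemma dist_calM_sym nu eta : dist_calM h nu eta = dist_calM h eta nu.
Proof.
by congr ereal_inf; apply/seteqP; split => _ [e [e0 [F /Gamma_sym GF]] <-];
  exists e.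
Qed.

Lemma dist_calM_eq0 nu eta : gauge_function h -> separable_space X ->
  dist_calM h nu eta = 0%E -> nu = eta.
Proof.
move=> gh sX nueta0.
have eqC (C : set X) : closed C -> nu C = eta C.
  move=> cC; apply/eqP; rewrite eq_le !dist_calM_eq0_le//.
  by rewrite dist_calM_sym.
apply: calM_ext => B mB.
apply: (@measure_unique _ R (borel X) (@open X) (fun=> setT) _ _ _ _ nu eta)
  => //.
- exact: openI.
- by move=> _; exact: openT.
- by rewrite bigcup_const.
- move=> U oU.
  have mC : measurable (~` U : set (borel X)).
    by apply: measurableC; exact: open_borel.
  have massDC (n : calM) : n U = (n setT - n (~` U))%E.
    rewrite -[in LHS](setCK U) -setTD measureD ?setTI//.
    by rewrite -ge0_fin_numE// calM_fin.
  suff nuetaU : nu U = eta U by exact: nuetaU.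
  by rewrite !massDC !eqC//; exact: open_closedC.
- by move=> _; rewrite -ge0_fin_numE// calM_fin.
Qed.

End calM_theory.

Theorem theorem4p8 (R : realType) (X : pointedMetricType R)
    (mu : {outer_measure set X -> \bar R}) (h : R -> R) :
  metric_measure_space mu -> gauge_function h ->
  is_metric_space (@dist_calM R X mu h).
Proof.
move=> /mms_separable sX gh; apply: is_metric_space_of_dist.
- move=> nu eta; rewrite dist_calM_ge0 -ge0_fin_numE ?dist_calM_ge0//.
  exact: dist_calM_fin.
- move=> nu; apply/eqP; rewrite eq_le dist_calM_ge0 andbT.
  apply/lee_addgt0Pr => e e0; rewrite add0e.
  by apply: dist_calM_le => //; exact: Gamma_refl.
- by move=> nu eta; exact: dist_calM_eq0.
- exact: dist_calM_sym.
- by move=> eta nu zeta; exact: dist_calM_triangle.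
Qed.
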